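(* Let $(X,d,W)$ be a complete $UCW$-hyperbolic space. Every bounded sequence $(x_n)$ in $X$ has a unique asymptotic center with respect to any nonempty closed convex subset $C$ of $X$.
   Context: A $W$-hyperbolic space $(X,d,W)$ is a metric space $(X,d)$ with a map $W:X\times X\times[0,1]\to X$ such that for all $x,y,z,w\in X$, $\lambda,\tilde\lambda\in[0,1]$: (W1) $d(z,W(x,y,\lambda))\le(1-\lambda)d(z,x)+\lambda d(z,y)$; (W2) $d(W(x,y,\lambda),W(x,y,\tilde\lambda))=|\lambda-\tilde\lambda|\,d(x,y)$; (W3) $W(x,y,\lambda)=W(y,x,1-\lambda)$; (W4) $d(W(x,z,\lambda),W(y,w,\lambda))\le(1-\lambda)d(x,y)+\lambda d(z,w)$. Write $(1-\lambda)x\oplus\lambda y:=W(x,y,\lambda)$. A nonempty $C\subseteq X$ is convex if $(1-\lambda)x\oplus\lambda y\in C$ for all $x,y\in C$, $\lambda\in[0,1]$. $(X,d,W)$ is uniformly convex with modulus of uniform convexity $\eta:(0,\infty)\times(0,2]\to(0,1]$ if for all $r>0$, $\varepsilon\in(0,2]$, $a,x,y\in X$: $d(x,a)\le r$, $d(y,a)\le r$, $d(x,y)\ge\varepsilon r$ imply $d(\frac12x\oplus\frac12y,a)\le(1-\eta(r,\varepsilon))r$. The modulus $\eta$ is monotone if it decreases with $r$ for fixed $\varepsilon$ (i.e. $\eta(s,\varepsilon)\le\eta(r,\varepsilon)$ whenever $s\ge r$). A $UCW$-hyperbolic space is a uniformly convex $W$-hyperbolic space admitting a monotone modulus of uniform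 convexity. For a bounded sequence $(x_n)$ in $X$ and $y\in X$, let $r(y,(x_n)):=\limsup_n d(y,x_n)$. For nonempty $C\subseteq X$, let $r(C,(x_n)):=\inf\{r(y,(x_n))\mid y\in C\}$. A point $c\in C$ is an asymptotic center of $(x_n)$ with respect to $C$ if $r(c,(x_n))=r(C,(x_n))$. *)

(* Defs.v *)
From HB Require Import structures.
From mathcomp Require Import all_boot all_order all_algebra.
From mathcomp Require Import all_classical all_reals all_analysis.

Set Implicit Arguments.
Unset Strict Implicit.
Unset Printing Implicit Defensive.

Import Order.TTheory GRing.Theory Num.Theory.
Import numFieldNormedType.Exports.

Local Open Scope classical_set_scope.
Local Open Scope ring_scope.

(* The library's complete uniform spaces are pointed; this excludes only the
   empty metric space. *)
#[short(type="completeMetricType")]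
HB.structure Definition CompleteMetric (R : realType) :=
  {T of Metric R T & Complete T}.

(* W x y l stands for (1 - l) x (+) l y. It is a total function of l : R, but
   only its values for l in [0, 1] are constrained or used. *)
Record W_hyperbolic (R : realType) (X : metricType R) (W : X -> X -> R -> X)
    : Prop := WHyperbolic {
  W1 : forall (x y z : X) (l : R), 0 <= l <= 1 ->
    mdist z (W x y l) <= (1 - l) * mdist z x + l * mdist z y ;
  W2 : forall (x y : X) (l l' : R), 0 <= l <= 1 -> 0 <= l' <= 1 ->
    mdist (W x y l) (W x y l') = `|l - l'| * mdist x y ;
  W3 : forall (x y : X) (l : R), 0 <= l <= 1 -> W x y l = W y x (1 - l) ;
  W4 : forall (x y z w : X) (l : R), 0 <= l <= 1 ->
    mdist (W x z l) (W y w l) <= (1 - l) * mdist x y + l * mdist z w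
}.

(* Nonemptiness of C is kept as a separate hypothesis. *)
Definition W_convex (R : realType) (X : metricType R) (W : X -> X -> R -> X)
    (C : set X) : Prop :=
  forall (x y : X) (l : R), C x -> C y -> 0 <= l <= 1 -> C (W x y l).

(* A modulus (0, oo) x (0, 2] -> (0, 1] is a total function of which only the
   values on that domain matter. *)
Definition modulus_of_uniform_convexity (R : realType) (X : metricType R)
    (W : X -> X -> R -> X) (eta : R -> R -> R) : Prop :=
  (forall r e : R, 0 < r -> 0 < e <= 2 -> 0 < eta r e <= 1) /\
  (forall (r e : R) (a x y : X), 0 < r -> 0 < e <= 2 ->
     mdist x a <= r -> mdist y a <= r -> e * r <= mdist x y ->
     mdist (W x y (1 / 2)) a <= (1 - eta r e) * r).

Definition monotone_modulus (R : realType) (eta : R -> R -> R) : Prop :=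
  forall r s e : R, 0 < r -> r <= s -> 0 < e <= 2 -> eta s e <= eta r e.

Definition UCW_hyperbolic (R : realType) (X : metricType R)
    (W : X -> X -> R -> X) : Prop :=
  W_hyperbolic W /\
  exists eta : R -> R -> R,
    modulus_of_uniform_convexity W eta /\ monotone_modulus eta.

Definition bounded_seq (R : realType) (X : metricType R) (x : nat -> X)
    : Prop :=
  exists M : R, forall m n : nat, mdist (x m) (x n) <= M.

(* Meaningful for bounded x only: limn_sup and inf are real-valued. *)
Definition asymptotic_radius_at (R : realType) (X : metricType R)
    (x : nat -> X) (y : X) : R :=
  limn_sup (fun n => mdist y (x n)).

Definition asymptotic_radius (R : realType) (X : metricType R)
    (x : nat -> X) (C : set X) : R :=
  inf [set asymptotic_radius_at x y | y in C].

Definition asymptotic_center (R : realType) (X : metricType R)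
    (x : nat -> X) (C : set X) (c : X) : Prop :=
  C c /\ asymptotic_radius_at x c = asymptotic_radius x C.

(* Main.v *)
Require Import Defs.
From mathcomp Require Import all_boot all_order all_algebra.
From mathcomp Require Import all_classical all_reals all_analysis.
From mathcomp Require Import lra.

(** Let [rho] be the asymptotic radius. If [y] and [z] in [C] have radius at
    most [rho + delta] but are [e] apart, uniform convexity applied around each
    [x n], [n] large, gives their midpoint a radius at most
    [(1 - t) (rho + delta)], where monotonicity makes [t > 0] independent of
    [delta <= 1]. This is less than [rho] for small [delta] when [rho > 0],
    contradicting minimality; when [rho = 0] the triangle inequality through
    [x n] already brings [y] and [z] together. So near-minimizers of the
    radius over [C] are close to one another: this yields uniqueness, and makes
    minimizing sequences Cauchy; their limits are asymptotic centers. *)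

Import Order.TTheory GRing.Theory Num.Theory.
Import numFieldNormedType.Exports.

Local Open Scope classical_set_scope.
Local Open Scope ring_scope.

(** The limit superior is the infimum of the tail suprema [sups u], so one of these is already below
    [r]; boundedness makes it an upper bound of its tail. *)
Lemma limn_sup_lt_near (R : realType) (u : nat -> R) (r : R) :
  bounded_fun (u : R^o ^nat) -> limn_sup u < r -> \forall n \near \oo, u n < r.
Proof.
move=> ub; rewrite limn_supE// => /inf_lt[|_ [N _ <-] uNr].
  by exists (sups u 0%N), 0%N.
exists N => // n /= Nn; apply: le_lt_trans uNr.
apply: ub_le_sup; last by exists n.
by have /bounded_fun_has_ubound/has_ubound_sdrop := ub; exact.
Qed.

Lemma limn_sup_le_near (R : realType) (u : nat -> R) (r : R) :
  bounded_fun (u : R^o ^nat) -> (\forall n \near \oo, u n <= r) ->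
  limn_sup u <= r.
Proof.
move=> ub [N _ uNr]; rewrite limn_supE//.
apply: (@le_trans _ _ (sups u N)).
  by apply: ge_inf; [exact: bounded_fun_has_lbound_sups|exists N].
apply: ge_sup; first by exists (u N), N => /=.
by move=> _ [n /= Nn <-]; exact: uNr.
Qed.

Section AsymptoticRadius.
Context (R : realType) (X : metricType R) (x : nat -> X).
Hypothesis x_bounded : bounded_seq x.

Lemma bounded_fun_mdist (y : X) :
  bounded_fun ((fun n => mdist y (x n)) : R^o ^nat).
Proof.
have [M xM] := x_bounded.
exists (mdist y (x 0%N) + M); split; first exact: num_real.
move=> r /ltW Mr n _ /=; rewrite ger0_norm ?mdist_ge0//.
apply: le_trans Mr; apply: le_trans (metric_triangle _ (x 0%N) _) _.
by rewrite lerD2l.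
Qed.

Lemma asymptotic_radius_at_lt (y : X) (r : R) :
  asymptotic_radius_at x y < r -> \forall n \near \oo, mdist y (x n) < r.
Proof. exact/limn_sup_lt_near/bounded_fun_mdist. Qed.

Lemma asymptotic_radius_at_le (y : X) (r : R) :
  (\forall n \near \oo, mdist y (x n) <= r) -> asymptotic_radius_at x y <= r.
Proof. exact/limn_sup_le_near/bounded_fun_mdist. Qed.

Lemma asymptotic_radius_at_ge0 (y : X) : 0 <= asymptotic_radius_at x y.
Proof.
rewrite leNgt; apply/negP => /asymptotic_radius_at_lt yx.
near \oo => n; have : mdist y (x n) < 0 by near: n.
by rewrite ltNge mdist_ge0.
Unshelve. all: by end_near. Qed.

(** Limit superior of the triangle inequality through [y]. This continuity of the radius carries
    minimality over to the limit of a minimizing sequence. *)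
Lemma asymptotic_radius_at_triangle (y z : X) :
  asymptotic_radius_at x z <= asymptotic_radius_at x y + mdist z y.
Proof.
apply/ler_addgt0Pl => e e0; apply: asymptotic_radius_at_le.
have /asymptotic_radius_at_lt : asymptotic_radius_at x y <
  asymptotic_radius_at x y + e by rewrite ltrDl.
apply: filterS => n yx; have := metric_triangle z y (x n); lra.
Qed.

Lemma asymptotic_radius_le (C : set X) (y : X) :
  C y -> asymptotic_radius x C <= asymptotic_radius_at x y.
Proof.
move=> Cy; apply: ge_inf; last by exists y.
by exists 0 => _ [z _ <-]; exact: asymptotic_radius_at_ge0.
Qed.

Lemma asymptotic_radius_ge0 (C : set X) : C !=set0 -> 0 <= asymptotic_radius x C.
Proof.
move=> [y Cy]; apply: lb_le_inf; first by exists (asymptotic_radius_at x y), y.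
by move=> _ [z _ <-]; exact: asymptotic_radius_at_ge0.
Qed.

Lemma asymptotic_radius_approx (C : set X) (e : R) : C !=set0 -> 0 < e ->
  exists2 y, C y & asymptotic_radius_at x y < asymptotic_radius x C + e.
Proof.
move=> [y0 Cy0] e0.
have [||_ [y Cy <-] ye] := @inf_lt R [set asymptotic_radius_at x y | y in C]
  (asymptotic_radius x C + e).
- by exists (asymptotic_radius_at x y0), y0.
- by rewrite ltrDl.
- by exists y.
Qed.

Lemma near_minimizers_close (W : X -> X -> R -> X) (C : set X) (e : R) :
  UCW_hyperbolic W -> C !=set0 -> W_convex W C -> 0 < e ->
  exists2 d : R, 0 < d & forall y z, C y -> C z ->
    asymptotic_radius_at x y < asymptotic_radius x C + d ->
    asymptotic_radius_at x z < asymptotic_radius x C + d -> mdist y z < e.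
Proof.
move=> [_ [eta [[eta01 etaP] eta_mono]]] C0 CW e0.
set rho := asymptotic_radius x C.
have : 0 <= rho by exact: asymptotic_radius_ge0.
rewrite le_eqVlt => /predU1P[<-|rho0].
  exists (e / 2) => [|y z Cy Cz]; first lra.
  rewrite add0r => /asymptotic_radius_at_lt ye /asymptotic_radius_at_lt ze.
  near \oo => n.
  have : mdist y (x n) < e / 2 by near: n.
  have : mdist z (x n) < e / 2 by near: n.
  rewrite [mdist z _]metric_sym; have := metric_triangle y (x n) z; lra.
(* [s] dominates every [rho + d] with [d <= 1], so [eta s k] can be fixed before [d] is chosen. *)
pose s := rho + 1; have s0 : 0 < s by rewrite /s; lra.
(* The cap at 2 keeps [k] in the domain of the modulus; [e / s] ensures [k * r <= e] for every
   [r <= s]. *)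
pose k := Num.min 2 (e / s).
have k02 : 0 < k <= 2 by rewrite lt_min ge_min lexx ltr0n divr_gt0.
have ks : k * s <= e by rewrite -ler_pdivlMr// ge_min lexx orbT.
pose t := eta s k; have /andP[t0 t1] : 0 < t <= 1 by exact: eta01.
(* With [d <= t * rho], the midpoint bound [(1 - t) * (rho + d)] is at most
   [(1 - t) * (1 + t) * rho], that is [rho - t * t * rho], which is less than [rho]. *)
pose d := Num.min 1 (t * rho).
have d0 : 0 < d by rewrite lt_min ltr01 mulr_gt0.
have d1 : d <= 1 by rewrite ge_min lexx.
have dt : d <= t * rho by rewrite ge_min lexx orbT.
exists d => // y z Cy Cz /asymptotic_radius_at_lt yd /asymptotic_radius_at_lt zd.
rewrite ltNge; apply/negP => eyz.
pose r := rho + d; have r0 : 0 < r by rewrite /r; lra.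
have rs : r <= s by rewrite /r /s; lra.
have m_le : asymptotic_radius_at x (W y z (1 / 2)) <= (1 - t) * r.
  apply: asymptotic_radius_at_le; near=> n.
  apply: (@le_trans _ _ ((1 - eta r k) * r)).
    apply: etaP => //.
    - by apply: ltW; near: n.
    - by apply: ltW; near: n.
    - apply: le_trans eyz; apply: le_trans ks.
      by rewrite ler_pM2l//; case/andP: k02.
  by rewrite ler_pM2r// lerD2l lerN2; exact: eta_mono.
have m_ge : rho <= asymptotic_radius_at x (W y z (1 / 2)).
  by apply/asymptotic_radius_le/CW => //; lra.
have : (1 - t) * r <= (1 - t) * (rho + t * rho).
  by rewrite ler_wpM2l /r ?lerD2l//; lra.
have : 0 < t * t * rho by rewrite !mulr_gt0.
lra.
Unshelve. all: by end_near. Qed.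

End AsymptoticRadius.

Theorem proposition3p3 (R : realType) (X : completeMetricType R)
  (W : X -> X -> R -> X) (hW : UCW_hyperbolic W)
  (x : nat -> X) (hx : bounded_seq x)
  (C : set X) (C_nonempty : C !=set0) (C_closed : closed C)
  (C_convex : W_convex W C) :
  exists! c : X, asymptotic_center x C c.
Proof.
have close (e : R) (e0 : 0 < e) :=
  near_minimizers_close _ _ _ hx _ _ _ hW C_nonempty C_convex e0.
set rho := asymptotic_radius x C in close *.
have /choice[y yP] (n : nat) :
    exists y, C y /\ asymptotic_radius_at x y < rho + n.+1%:R^-1.
  have n0 : 0 < n.+1%:R^-1 :> R by rewrite invr_gt0.
  have [y Cy yn] := asymptotic_radius_approx _ _ x _ _ C_nonempty n0.
  by exists y.
have y_near (d : R) : 0 < d ->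
    \forall n \near \oo, asymptotic_radius_at x (y n) < rho + d.
  move=> d0; have := near_infty_natSinv_lt (PosNum d0).
  apply: filterS => n /= nd.
  by apply: lt_trans (yP n).2 _; rewrite ltrD2l.
have /cauchy_cvgP/cvg_ex[c yc] : cauchy (y @ \oo).
  (* It suffices to find, for each [e], one ball of radius [e] containing a tail; a late term [y N]
     serves as its center. *)
  apply: cauchy_exP => e e0; have [d d0 de] := close e e0.
  have [N _ yN] := y_near d d0; exists (y N); rewrite ballEmdist.
  exists N => // n /= Nn.
  apply: de; [exact: (yP N).1|exact: (yP n).1|exact: yN (leqnn N)|exact: yN].
have cC : asymptotic_center x C c.
  have Cc : C c.
    apply: (closed_cvg _ C_closed _ _ yc).
    by apply: nearW => n; exact: (yP n).1.
  split=> //; apply/eqP; rewrite eq_le asymptotic_radius_le// andbT.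
  apply/ler_addgt0Pl => e e0; have e20 : 0 < e / 2 by lra.
  near \oo => n.
  have : asymptotic_radius_at x (y n) < rho + e / 2 by near: n; exact: y_near.
  have : mdist c (y n) < e / 2
    by near: n; exact: (metricType_numDomainType.cvgr_dist_lt yc e20).
  by have := asymptotic_radius_at_triangle _ _ _ hx (y n) c; lra.
exists c; split => // z [Cz zrho].
(* Both centers have radius exactly [rho], below [rho + d] for every [d > 0], so their distance is
   below every [e > 0]. *)
apply/mdist_positivity/eqP; rewrite eq_le mdist_ge0 andbT.
apply/ler_addgt0Pl => e e0; rewrite addr0 ltW//.
have [d d0] := close e e0; apply => //.
- by case: cC.
- by rewrite (cC.2) ltrDl.
- by rewrite zrho ltrDl.
Unshelve. all: by end_near. Qed.
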